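(* Let $a,k,\gamma,u_\infty>0$ be constants, let $\beta,\delta$ be real constants with $\beta\ge\delta$ and $\beta+\delta+1>0$, and put $\alpha=\beta-\delta$. For $h_0>0$ let $\xi_R(h_0)$, $s_R(t,h_0)$, $u_R(x,t,h_0)$ be the coefficient, free boundary and temperature of the similarity type solution of the Robin problem $(P_R)$ with parameter $h_0$, and let $\xi_{D\infty}$, $s_{D\infty}(t)$, $u_{D\infty}(x,t)$ be those of the Dirichlet problem $(P_{D\infty})$ (both problems and their solutions are given explicitly in the context). Then problem $(P_R)$ converges to problem $(P_{D\infty})$ as $h_0\to+\infty$, in the sense that $$\lim_{h_0\to+\infty}\xi_R(h_0)=\xi_{D\infty},\qquad \lim_{h_0\to+\infty}s_R(t,h_0)=s_{D\infty}(t)\ \ \text{for all } t>0,$$ $$\lim_{h_0\to+\infty}u_R(x,t,h_0)=u_{D\infty}(x,t)\ \ \text{for all } t>0,\ x>0.$$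
   Context: $M$ is Kummer's confluent hypergeometric function of the first kind, $M(p,q,z)=\sum_{n=0}^{\infty}\frac{(p)_n}{(q)_n}\frac{z^n}{n!}$, with $(p)_0=1$, $(p)_n=p(p+1)\cdots(p+n-1)$. Both problems ask for $u(x,t)$ and $s(t)$ satisfying $$\frac{\partial u}{\partial t}=a^2\frac{\partial^2u}{\partial x^2}\ (0<x<s(t),\ t>0),\quad u(s(t),t)=0,\quad -k\frac{\partial u}{\partial x}(s(t),t)=\gamma s^{\beta}(t)\dot s^{\delta}(t)\dot s(t)\ (t>0),\quad s(0)=0,$$ together with, for $(P_R)$, $k\frac{\partial u}{\partial x}(0,t)=\frac{h_0}{\sqrt t}\left[u(0,t)-u_\infty t^{\alpha/2}\right]$, $t>0$, and, for $(P_{D\infty})$, $u(0,t)=u_\infty t^{\alpha/2}$, $t>0$. Let $\eta=\frac{x}{2a\sqrt t}$. The similarity type solution of $(P_R)$ is $$u_R(x,t,h_0)=t^{\alpha/2}\left[C_{1R}M\left(-\tfrac{\alpha}{2},\tfrac12,-\eta^2\right)+C_{2R}\eta M\left(-\tfrac{\alpha}{2}+\tfrac12,\tfrac32,-\eta^2\right)\right],\qquad s_R(t,h_0)=2\xi_Ra\sqrt t,$$ where $\xi_R=\xi_R(h_0)$ is the unique positive solution of $$\frac{ku_\infty}{\gamma2^{\beta+1}a^{\beta+\delta+2}}\cdot\frac{1}{\frac{k}{2ah_0}M(\frac{\alpha}{2}+\frac12,\frac12,z^2)+zM(\frac{\alpha}{2}+1,\frac32,z^2)}=z^{\beta+\delta+1},\quad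 z>0,$$ and, with $D=\frac{k}{2ah_0}M(-\frac{\alpha}{2},\frac12,-\xi_R^2)+\xi_RM(-\frac{\alpha}{2}+\frac12,\frac32,-\xi_R^2)$, $C_{1R}=u_\infty\xi_RM(-\frac{\alpha}{2}+\frac12,\frac32,-\xi_R^2)/D$ and $C_{2R}=-u_\infty M(-\frac{\alpha}{2},\frac12,-\xi_R^2)/D$. The similarity type solution of $(P_{D\infty})$ is $$u_{D\infty}(x,t)=t^{\alpha/2}\left[u_\infty M\left(-\tfrac{\alpha}{2},\tfrac12,-\eta^2\right)-\frac{u_\infty M(-\frac{\alpha}{2},\frac12,-\xi_{D\infty}^2)}{\xi_{D\infty}M(-\frac{\alpha}{2}+\frac12,\frac32,-\xi_{D\infty}^2)}\,\eta M\left(-\tfrac{\alpha}{2}+\tfrac12,\tfrac32,-\eta^2\right)\right],\qquad s_{D\infty}(t)=2\xi_{D\infty}a\sqrt t,$$ where $\xi_{D\infty}$ is the unique positive solution of $$\frac{ku_\infty}{\gamma2^{\beta+1}a^{\beta+\delta+2}}\cdot\frac{1}{zM(\frac{\alpha}{2}+1,\frac32,z^2)}=z^{\beta+\delta+1},\quad z>0.$$ The formulas for $u_R$ and $u_{D\infty}$ are understood as defining these functions for all $x>0$, $t>0$. *)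

(* Defs.v *)
From Stdlib Require Import Reals Factorial Lra.
From Coquelicot Require Import Coquelicot.
Open Scope R_scope.

(** Rising factorial [(p)_n = p (p+1) ... (p+n-1)]. *)
Fixpoint pochhammer (p : R) (n : nat) : R :=
  match n with
  | O => 1
  | S m => pochhammer p m * (p + INR m)
  end.

(** Kummer's function of the first kind.  [PSeries] is total, but for
    [q = 1/2] and [q = 3/2], the only values used below, the denominators do
    not vanish and the radius of convergence is infinite. *)
Definition kummerM (p q z : R) : R :=
  PSeries (fun n => pochhammer p n / pochhammer q n / INR (fact n)) z.

(** Real powers are written [Rpower]; their bases ([2], [a], [z] and [t]) are
    positive wherever these definitions are used. *)
Definition stefan_const (a k gamma uinf beta delta : R) : R :=
  k * uinf / (gamma * Rpower 2 (beta + 1) * Rpower a (beta + delta + 2)).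

Definition robin_eq (a k gamma uinf alpha beta delta h0 z : R) : Prop :=
  stefan_const a k gamma uinf beta delta
  * (1 / (k / (2 * a * h0) * kummerM (alpha / 2 + 1 / 2) (1 / 2) (z ^ 2)
          + z * kummerM (alpha / 2 + 1) (3 / 2) (z ^ 2)))
  = Rpower z (beta + delta + 1).

Definition dirichlet_eq (a k gamma uinf alpha beta delta z : R) : Prop :=
  stefan_const a k gamma uinf beta delta
  * (1 / (z * kummerM (alpha / 2 + 1) (3 / 2) (z ^ 2)))
  = Rpower z (beta + delta + 1).

Definition is_xiR (a k gamma uinf alpha beta delta h0 xi : R) : Prop :=
  unique (fun z => 0 < z /\ robin_eq a k gamma uinf alpha beta delta h0 z) xi.

Definition is_xiD (a k gamma uinf alpha beta delta xi : R) : Prop :=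
  unique (fun z => 0 < z /\ dirichlet_eq a k gamma uinf alpha beta delta z) xi.

(** The similarity variable [x / (2 a sqrt t)]. *)
Definition eta (a x t : R) : R := x / (2 * a * sqrt t).

(** Common shape of both free boundaries, for a given coefficient [xi]. *)
Definition free_boundary (a xi t : R) : R := 2 * xi * a * sqrt t.

Definition robin_D (a k alpha h0 xi : R) : R :=
  k / (2 * a * h0) * kummerM (- alpha / 2) (1 / 2) (- (xi ^ 2))
  + xi * kummerM (- alpha / 2 + 1 / 2) (3 / 2) (- (xi ^ 2)).

Definition C1R (a k uinf alpha h0 xi : R) : R :=
  uinf * xi * kummerM (- alpha / 2 + 1 / 2) (3 / 2) (- (xi ^ 2))
  / robin_D a k alpha h0 xi.

Definition C2R (a k uinf alpha h0 xi : R) : R :=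
  - uinf * kummerM (- alpha / 2) (1 / 2) (- (xi ^ 2))
  / robin_D a k alpha h0 xi.

Definition uR (a k uinf alpha h0 xi x t : R) : R :=
  Rpower t (alpha / 2)
  * (C1R a k uinf alpha h0 xi
       * kummerM (- alpha / 2) (1 / 2) (- (eta a x t ^ 2))
     + C2R a k uinf alpha h0 xi * eta a x t
       * kummerM (- alpha / 2 + 1 / 2) (3 / 2) (- (eta a x t ^ 2))).

Definition uD (a uinf alpha xi x t : R) : R :=
  Rpower t (alpha / 2)
  * (uinf * kummerM (- alpha / 2) (1 / 2) (- (eta a x t ^ 2))
     - uinf * kummerM (- alpha / 2) (1 / 2) (- (xi ^ 2))
       / (xi * kummerM (- alpha / 2 + 1 / 2) (3 / 2) (- (xi ^ 2)))
       * eta a x t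
       * kummerM (- alpha / 2 + 1 / 2) (3 / 2) (- (eta a x t ^ 2))).

(* Main.v *)
(** The Dirichlet equation reads [G z = c] and the Robin equation
    [G z + e F z = c] with [e = k / (2 a h0)], where [F] is nonnegative and
    [F], [G] are increasing.  Hence [xi_R <= xi_D]; and for [r < xi_D] we have
    [G r < c], so [G r + e F r < c] as soon as [e] is small, which forces
    [r < xi_R].  The limit of [u_R] then follows by continuity once the limit
    [xi_D M(1/2 - alpha/2, 3/2, -xi_D^2)] of [D] is known to be nonzero:
    Kummer's transformation [M(q-p, q, -z) = exp(-z) M(p, q, z)] turns it into
    a series with positive terms. *)
Require Import Defs.
From Stdlib Require Import Reals Factorial Lra Lia.
From Coquelicot Require Import Coquelicot.
Open Scope R_scope.

(** * Rising factorials and the Chu-Vandermonde identity *)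

Lemma sum_binomial_succ (u : nat -> R) (n : nat) :
  sum_f_R0 (fun i => Binomial.C (S n) i * u i) (S n)
  = sum_f_R0 (fun i => Binomial.C n i * (u i + u (S i))) n.
Proof.
assert (C0 : forall m, Binomial.C m 0 = 1).
{ intros m; unfold Binomial.C; rewrite Nat.sub_0_r; simpl.
  field; apply INR_fact_neq_0. }
assert (Cn : forall m, Binomial.C m m = 1).
{ intros m; unfold Binomial.C; rewrite Nat.sub_diag; simpl.
  field; apply INR_fact_neq_0. }
rewrite (sum_eq _ (fun i => Binomial.C n i * u i + Binomial.C n i * u (S i)) n)
  by (intros; ring).
rewrite sum_plus.
destruct n as [|m].
{ simpl; rewrite !C0, Cn; ring. }
(* The end indices [0] and [S (S m)], where Pascal's rule does not apply, are split off; the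
   remaining sums all run over [u (S i)] with [i <= m]. *)
rewrite (decomp_sum _ (S (S m))) by lia.
rewrite (decomp_sum (fun i => Binomial.C (S m) i * u i)) by lia.
cbn [Init.Nat.pred].
rewrite (tech5 (fun i => Binomial.C (S (S m)) (S i) * u (S i))).
rewrite (tech5 (fun i => Binomial.C (S m) i * u (S i))).
rewrite (sum_eq (fun i => Binomial.C (S (S m)) (S i) * u (S i))
  (fun i => Binomial.C (S m) (S i) * u (S i) + Binomial.C (S m) i * u (S i)) m).
2:{ intros i Hi; rewrite <- pascal by lia; ring. }
rewrite sum_plus, !C0, !Cn; ring.
Qed.

Lemma pochhammer_pos (p : R) (n : nat) : 0 < p -> 0 < pochhammer p n.
Proof.
intros Hp; induction n as [|n IH]; simpl; [lra|].
apply Rmult_lt_0_compat; [exact IH|].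
pose proof (pos_INR n); lra.
Qed.

Lemma pochhammer_succ_l (p : R) (n : nat) :
  pochhammer p (S n) = p * pochhammer (p + 1) n.
Proof.
induction n as [|n IH]; [simpl; ring|].
change (pochhammer p (S (S n))) with (pochhammer p (S n) * (p + INR (S n))).
rewrite IH, S_INR; simpl; ring.
Qed.

(** Lets a Kummer series with arbitrary first parameter be dominated by one with a positive
    parameter. *)
Lemma pochhammer_le (p p' : R) (n : nat) :
  Rabs p <= p' -> Rabs (pochhammer p n) <= pochhammer p' n.
Proof.
intros Hp; induction n as [|n IH]; simpl; [rewrite Rabs_R1; lra|].
rewrite Rabs_mult.
apply Rmult_le_compat; try apply Rabs_pos; [exact IH|].
eapply Rle_trans; [apply Rabs_triang|].
rewrite (Rabs_pos_eq (INR n)) by apply pos_INR; lra.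
Qed.

(** Induction on [n] for all [p] and [q]: Pascal's rule yields the sum at [(p, q)] and [- p / q]
    times the sum at [(p + 1, q + 1)]. Both pairs have the difference [q - p], so the two values
    share their numerator. *)
Lemma chu_vandermonde (p q : R) (n : nat) : 0 < q ->
  sum_f_R0 (fun i => Binomial.C n i
              * ((-1) ^ i * pochhammer p i / pochhammer q i)) n
  = pochhammer (q - p) n / pochhammer q n.
Proof.
revert p q; induction n as [|n IH]; intros p q Hq.
{ simpl; unfold Binomial.C; simpl; field. }
rewrite sum_binomial_succ.
rewrite (sum_eq _ (fun i =>
  Binomial.C n i * ((-1) ^ i * pochhammer p i / pochhammer q i)
  + Binomial.C n i * ((-1) ^ i * pochhammer (p + 1) i / pochhammer (q + 1) i)
    * (- (p / q)))).
2:{ intros i _; rewrite !pochhammer_succ_l.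
    pose proof (pochhammer_pos q i Hq).
    assert (0 < pochhammer (q + 1) i) by (apply pochhammer_pos; lra).
    simpl pow; field; lra. }
rewrite sum_plus, <- scal_sum, !IH by lra.
replace (q + 1 - (p + 1)) with (q - p) by ring.
pose proof (pochhammer_pos q n Hq).
assert (0 < pochhammer (q + 1) n) by (apply pochhammer_pos; lra).
pose proof (pos_INR n).
assert (E : pochhammer (q + 1) n = pochhammer q n * (q + INR n) / q).
{ change (pochhammer q n * (q + INR n)) with (pochhammer q (S n)).
  rewrite pochhammer_succ_l; field; lra. }
rewrite E; simpl; field; lra.
Qed.

(** * Convergence of the Kummer series *)

(** Convergence for [v] at [r] makes [v n * r ^ n] bounded, hence also [u n * r ^ n]; so every real
    [r] is at most the radius of [u]. *)
Lemma CV_radius_infinite_le (u v : nat -> R) :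
  (forall n, Rabs (u n) <= Rabs (v n)) ->
  CV_radius v = p_infty -> CV_radius u = p_infty.
Proof.
intros Huv Hv.
destruct (CV_radius_bounded u) as [Hub _].
assert (Hr : forall r : R, Rbar_le r (CV_radius u)).
{ intros r; apply Hub.
  assert (Hs : ex_series (fun n => Rabs (v n * r ^ n)))
    by (apply CV_disk_inside; rewrite Hv; exact I).
  apply ex_series_lim_0 in Hs.
  destruct (filterlim_bounded (K := R_AbsRing) (V := R_NormedModule)
    (fun n => Rabs (v n * r ^ n))) as [M HM].
  { exists 0; exact Hs. }
  exists M; intros n; eapply Rle_trans; [|apply (HM n)].
  change (Rabs (u n * r ^ n) <= Rabs (Rabs (v n * r ^ n))).
  rewrite Rabs_Rabsolu, !Rabs_mult.
  apply Rmult_le_compat_r; [apply Rabs_pos|apply Huv]. }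
destruct (CV_radius u) as [c| |]; [|reflexivity|destruct (Hr 0)].
exfalso; specialize (Hr (c + 1)); simpl in Hr; lra.
Qed.

Lemma CV_radius_inv_fact : CV_radius (fun n => / INR (fact n)) = p_infty.
Proof.
apply CV_radius_infinite_DAlembert.
{ intros n; apply Rinv_neq_0_compat, INR_fact_neq_0. }
apply is_lim_seq_ext with (fun n => / INR (S n)).
{ intros n; rewrite fact_simpl, mult_INR.
  pose proof (INR_fact_neq_0 n); pose proof (lt_0_INR (S n) ltac:(lia)).
  rewrite <- (Rabs_pos_eq (/ INR (S n))) at 1
    by (left; apply Rinv_0_lt_compat; lra).
  f_equal; field; lra. }
apply (is_lim_seq_incr_1 (fun n => / INR n)).
apply (is_lim_seq_inv _ p_infty); [apply is_lim_seq_INR|discriminate].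
Qed.

(** Convertible with the sequence inside [kummerM], so that facts about its radius apply there
    directly. *)
Definition kummer_coef (p q : R) (n : nat) : R :=
  pochhammer p n / pochhammer q n / INR (fact n).

Lemma CV_radius_kummer_pos (p q : R) : 0 < p -> 0 < q ->
  CV_radius (kummer_coef p q) = p_infty.
Proof.
intros Hp Hq.
apply CV_radius_infinite_DAlembert.
{ intros n; unfold kummer_coef.
  pose proof (pochhammer_pos p n Hp); pose proof (pochhammer_pos q n Hq).
  pose proof (INR_fact_lt_0 n).
  apply Rgt_not_eq; repeat apply Rdiv_lt_0_compat; assumption. }
(* [(p+n) / (q+n) <= 1 + p/q], which keeps the ratio below [(1 + p/q) / (n+1)]. *)
apply is_lim_seq_le_le with (fun _ => 0) (fun n => (1 + p / q) * / INR (S n)).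
{ intros n; split; [apply Rabs_pos|].
  unfold kummer_coef; rewrite fact_simpl, mult_INR; cbn [pochhammer].
  pose proof (pochhammer_pos p n Hp); pose proof (pochhammer_pos q n Hq).
  pose proof (INR_fact_lt_0 n); pose proof (pos_INR n).
  pose proof (lt_0_INR (S n) ltac:(lia)).
  match goal with |- Rabs ?x <= _ =>
    replace x with ((p + INR n) / (q + INR n) * / INR (S n)) by (field; lra)
  end.
  assert (0 < / INR (S n)) by (apply Rinv_0_lt_compat; lra).
  assert (0 < (p + INR n) / (q + INR n)) by (apply Rdiv_lt_0_compat; lra).
  rewrite Rabs_pos_eq by (apply Rlt_le, Rmult_lt_0_compat; lra).
  apply Rmult_le_compat_r; [lra|].
  apply Rle_div_l; [lra|].
  replace ((1 + p / q) * (q + INR n)) with (q + INR n + p + p / q * INR n)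
    by (field; lra).
  assert (0 < p / q) by (apply Rdiv_lt_0_compat; lra).
  nra. }
{ apply is_lim_seq_const. }
replace (Finite 0) with (Rbar_mult (1 + p / q) 0)
  by (simpl; f_equal; ring).
apply is_lim_seq_scal_l, (is_lim_seq_incr_1 (fun n => / INR n)).
apply (is_lim_seq_inv _ p_infty); [apply is_lim_seq_INR|discriminate].
Qed.

(** When [p] is zero or a negative integer, the coefficients eventually vanish and the ratio test
    does not apply; comparison with the positive parameter [Rabs p + 1] covers every [p]. *)
Lemma CV_radius_kummer (p q : R) : 0 < q ->
  CV_radius (kummer_coef p q) = p_infty.
Proof.
intros Hq.
apply CV_radius_infinite_le with (kummer_coef (Rabs p + 1) q).
2:{ apply CV_radius_kummer_pos; [pose proof (Rabs_pos p); lra|exact Hq]. }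
intros n; unfold kummer_coef.
pose proof (pochhammer_pos q n Hq); pose proof (INR_fact_lt_0 n).
unfold Rdiv; rewrite !Rabs_mult.
apply Rmult_le_compat_r; [apply Rabs_pos|].
apply Rmult_le_compat_r; [apply Rabs_pos|].
eapply Rle_trans; [|apply Rle_abs].
apply pochhammer_le; lra.
Qed.

(** * Continuity, transformation and monotonicity of Kummer's function *)

Lemma continuous_kummerM (p q z : R) : 0 < q -> continuous (kummerM p q) z.
Proof.
intros Hq; apply continuity_pt_filterlim.
apply (PSeries_continuity (kummer_coef p q)).
rewrite CV_radius_kummer by exact Hq; exact I.
Qed.

(** In the Cauchy product of the two series on the left, the coefficient of [z ^ n] is the
    Chu-Vandermonde sum divided by [n!]. *)
Lemma kummerM_transform (p q z : R) : 0 < q ->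
  exp z * kummerM p q (- z) = kummerM (q - p) q z.
Proof.
intros Hq.
set (c := fun n => (-1) ^ n * kummer_coef p q n).
assert (Ec : kummerM p q (- z) = PSeries c z).
{ apply Series_ext; intros n; unfold c, kummer_coef.
  replace (- z) with (-1 * z) by ring; rewrite Rpow_mult_distr; ring. }
assert (Rc : CV_radius c = p_infty).
{ apply CV_radius_infinite_le with (kummer_coef p q);
    [|apply CV_radius_kummer, Hq].
  intros n; unfold c; rewrite Rabs_mult, pow_1_abs; lra. }
rewrite Ec, Rmult_comm, exp_Reals.
rewrite <- PSeries_mult;
  [|rewrite Rc; exact I|rewrite CV_radius_inv_fact; exact I].
apply PSeries_ext; intros n.
rewrite <- chu_vandermonde by exact Hq.
unfold PS_mult, Rdiv; rewrite (Rmult_comm _ (/ INR (fact n))), scal_sum.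
apply sum_eq; intros i _; unfold c, kummer_coef, Binomial.C.
pose proof (pochhammer_pos q i Hq).
pose proof (INR_fact_lt_0 n); pose proof (INR_fact_lt_0 i).
pose proof (INR_fact_lt_0 (n - i)).
field; lra.
Qed.

(** All coefficients are positive, so the series compare term by term. *)
Lemma kummerM_incr (p q x y : R) : 0 < p -> 0 < q -> 0 <= x <= y ->
  kummerM p q x <= kummerM p q y.
Proof.
intros Hp Hq Hxy; apply Series_le.
{ intros n.
  assert (0 < pochhammer p n / pochhammer q n / INR (fact n)).
  { pose proof (pochhammer_pos p n Hp); pose proof (pochhammer_pos q n Hq).
    pose proof (INR_fact_lt_0 n); repeat apply Rdiv_lt_0_compat; assumption. }
  split.
  - apply Rmult_le_pos; [lra|apply pow_le; lra].
  - apply Rmult_le_compat_l; [lra|apply pow_incr; lra]. }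
apply ex_pseries_R, (CV_radius_inside (kummer_coef p q)).
rewrite CV_radius_kummer by exact Hq; exact I.
Qed.

Lemma kummerM_ge_1 (p q x : R) : 0 < p -> 0 < q -> 0 <= x ->
  1 <= kummerM p q x.
Proof.
intros Hp Hq Hx.
replace 1 with (kummerM p q 0); [apply kummerM_incr; lra|].
unfold kummerM; rewrite PSeries_0; simpl; field.
Qed.

(** * Limits of products, quotients and Kummer values *)

Lemma is_lim_Rmult (f g : R -> R) (x : Rbar) (l m : R) :
  is_lim f x l -> is_lim g x m -> is_lim (fun y => f y * g y) x (l * m).
Proof. intros Hf Hg; exact (is_lim_mult f g x l m Hf Hg I). Qed.

Lemma is_lim_Rdiv (f g : R -> R) (x : Rbar) (l m : R) : m <> 0 ->
  is_lim f x l -> is_lim g x m -> is_lim (fun y => f y / g y) x (l / m).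
Proof.
intros Hm Hf Hg; apply is_lim_Rmult; [exact Hf|].
apply (is_lim_inv g x m Hg); intros E; injection E; exact Hm.
Qed.

Lemma is_lim_kummerM (f : R -> R) (x : Rbar) (p q l : R) : 0 < q ->
  is_lim f x l -> is_lim (fun y => kummerM p q (f y)) x (kummerM p q l).
Proof.
intros Hq Hf; apply (is_lim_comp_continuous f (kummerM p q) x l Hf).
apply continuous_kummerM, Hq.
Qed.

(** * Convergence of the free boundary coefficient *)

(* Covers the Robin equation for [e = k / (2 a h0)] and the Dirichlet one for
   [e = 0]. *)
Definition stefan_lhs (alpha s e z : R) : R :=
  Rpower z s * (e * kummerM (alpha / 2 + 1 / 2) (1 / 2) (z ^ 2)
                + z * kummerM (alpha / 2 + 1) (3 / 2) (z ^ 2)).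

(** Both factors are positive and increase strictly: the power because [0 < s], the bracket because
    its second Kummer value is at least 1. *)
Lemma stefan_lhs_incr (alpha s e y z : R) :
  0 <= alpha -> 0 < s -> 0 <= e -> 0 < y < z ->
  stefan_lhs alpha s e y < stefan_lhs alpha s e z.
Proof.
intros Hal Hs He Hyz; unfold stefan_lhs.
assert (Hsq : 0 <= y ^ 2 <= z ^ 2) by (split; nra).
pose proof (kummerM_incr (alpha / 2 + 1 / 2) (1 / 2) _ _
  ltac:(lra) ltac:(lra) Hsq).
pose proof (kummerM_incr (alpha / 2 + 1) (3 / 2) _ _
  ltac:(lra) ltac:(lra) Hsq).
pose proof (kummerM_ge_1 (alpha / 2 + 1 / 2) (1 / 2) (y ^ 2)
  ltac:(lra) ltac:(lra) ltac:(lra)).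
pose proof (kummerM_ge_1 (alpha / 2 + 1) (3 / 2) (y ^ 2)
  ltac:(lra) ltac:(lra) ltac:(lra)).
pose proof (Rlt_Rpower_l y z s Hs Hyz).
assert (0 < Rpower y s) by apply exp_pos.
apply Rmult_le_0_lt_compat; [lra|nra|lra|].
apply Rplus_le_lt_compat; [apply Rmult_le_compat_l; lra|nra].
Qed.

(** Both Kummer values are at least 1, so the denominator is positive and can be cleared. *)
Lemma stefan_lhs_of_eq (alpha s e c z : R) :
  0 <= alpha -> 0 <= e -> 0 < z ->
  c * (1 / (e * kummerM (alpha / 2 + 1 / 2) (1 / 2) (z ^ 2)
            + z * kummerM (alpha / 2 + 1) (3 / 2) (z ^ 2))) = Rpower z s ->
  stefan_lhs alpha s e z = c.
Proof.
intros Hal He Hz E; unfold stefan_lhs; rewrite <- E; field.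
pose proof (kummerM_ge_1 (alpha / 2 + 1 / 2) (1 / 2) (z ^ 2)
  ltac:(lra) ltac:(lra) ltac:(nra)).
pose proof (kummerM_ge_1 (alpha / 2 + 1) (3 / 2) (z ^ 2)
  ltac:(lra) ltac:(lra) ltac:(nra)).
nra.
Qed.

Lemma is_lim_stefan_root (alpha s c xD : R) (e xi : R -> R) :
  0 <= alpha -> 0 < s ->
  (forall h, 0 < h -> 0 <= e h) -> is_lim e p_infty 0 ->
  (forall h, 0 < h -> 0 < xi h /\ stefan_lhs alpha s (e h) (xi h) = c) ->
  0 < xD -> stefan_lhs alpha s 0 xD = c ->
  is_lim xi p_infty xD.
Proof.
intros Hal Hs He He0 Hxi HxD ED.
apply is_lim_spec; intros eps.
(* The bound [xD / 2] keeps [r] positive when [eps] is large, since monotonicity is available on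
   positive arguments. *)
set (r := Rmax (xD - eps) (xD / 2)).
assert (Hr : 0 < r < xD).
{ unfold r; pose proof (cond_pos eps); split.
  - eapply Rlt_le_trans; [|apply Rmax_r]; lra.
  - apply Rmax_lub_lt; lra. }
assert (Hgap : stefan_lhs alpha s 0 r < c)
  by (rewrite <- ED; apply stefan_lhs_incr; lra).
assert (Hlim : is_lim (fun h => stefan_lhs alpha s (e h) r) p_infty
                 (stefan_lhs alpha s 0 r)).
{ apply is_lim_Rmult; [apply is_lim_const|].
  apply is_lim_plus'; [|apply is_lim_const].
  apply is_lim_Rmult; [exact He0|apply is_lim_const]. }
apply is_lim_spec in Hlim.
(* The tolerance is the gap [c - stefan_lhs alpha s 0 r], so that [stefan_lhs alpha s (e h) r] stays
   below [c]. *)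
destruct (Hlim (mkposreal _ (proj2 (Rlt_0_minus _ _) Hgap))) as [A HA].
exists (Rmax A 0); intros h Hh.
assert (HhA : A < h) by (eapply Rle_lt_trans; [apply Rmax_l|exact Hh]).
assert (Hh0 : 0 < h) by (eapply Rle_lt_trans; [apply Rmax_r|exact Hh]).
specialize (HA h HhA); simpl in HA; apply Rabs_def2 in HA.
destruct (Hxi h Hh0) as [Hpos Eh]; specialize (He h Hh0).
assert (r < xi h).
{ destruct (Rlt_le_dec r (xi h)) as [|[Hlt|Heq]]; [assumption| |].
  - pose proof (stefan_lhs_incr alpha s (e h) (xi h) r Hal Hs He
      (conj Hpos Hlt)); lra.
  - rewrite Heq in Eh; lra. }
assert (xi h <= xD).
(* Beyond [xD] the left side exceeds [c] already for [e = 0], and the term carrying [e h] is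
   nonnegative. *)
{ destruct (Rle_lt_dec (xi h) xD) as [|Hlt]; [assumption|].
  pose proof (stefan_lhs_incr alpha s 0 xD (xi h) Hal Hs (Rle_refl 0)
    (conj HxD Hlt)) as Hinc.
  unfold stefan_lhs in *.
  assert (0 < Rpower (xi h) s) by apply exp_pos.
  pose proof (kummerM_ge_1 (alpha / 2 + 1 / 2) (1 / 2) (xi h ^ 2)
    ltac:(lra) ltac:(lra) ltac:(nra)).
  assert (0 <= Rpower (xi h) s
               * (e h * kummerM (alpha / 2 + 1 / 2) (1 / 2) (xi h ^ 2)))
    by (repeat apply Rmult_le_pos; lra).
  lra. }
pose proof (Rmax_l (xD - eps) (xD / 2) : xD - eps <= r).
apply Rabs_def1; pose proof (cond_pos eps); lra.
Qed.

(** * Convergence of the temperature *)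

(** Kummer's transformation changes the first parameter to [alpha / 2 + 1], positive even where
    [- alpha / 2 + 1 / 2] is not. *)
Lemma kummerM_neg_pos (alpha z : R) : 0 <= alpha -> 0 <= z ->
  0 < kummerM (- alpha / 2 + 1 / 2) (3 / 2) (- z).
Proof.
intros Hal Hz; apply Rmult_lt_reg_l with (exp z); [apply exp_pos|].
rewrite Rmult_0_r, kummerM_transform by lra.
replace (3 / 2 - (- alpha / 2 + 1 / 2)) with (alpha / 2 + 1) by field.
eapply Rlt_le_trans; [apply Rlt_0_1|apply kummerM_ge_1; lra].
Qed.

Lemma is_lim_uR (a k uinf alpha x t xD : R) (xi : R -> R) :
  0 <= alpha -> 0 < xD ->
  is_lim (fun h0 => k / (2 * a * h0)) p_infty 0 ->
  is_lim xi p_infty xD ->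
  is_lim (fun h0 => uR a k uinf alpha h0 (xi h0) x t) p_infty
    (uD a uinf alpha xD x t).
Proof.
intros Hal HxD He Hxi.
set (A := kummerM (- alpha / 2) (1 / 2) (- xD ^ 2)).
set (B := kummerM (- alpha / 2 + 1 / 2) (3 / 2) (- xD ^ 2)).
assert (HB : 0 < B) by (apply kummerM_neg_pos; nra).
(* [- xi h0 ^ 2] parses as [- (xi h0 ^ 2)], the argument occurring in [robin_D]. *)
assert (Hsq : is_lim (fun h0 => - xi h0 ^ 2) p_infty (- xD ^ 2)).
{ apply (is_lim_opp _ _ (xD ^ 2)).
  apply (is_lim_comp_continuous xi (fun y => y ^ 2) _ _ Hxi).
  apply (ex_derive_continuous (fun y : R => y ^ 2)); auto_derive; exact I. }
pose proof (is_lim_kummerM _ _ (- alpha / 2) (1 / 2) _ ltac:(lra) Hsq) as HlA.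
pose proof (is_lim_kummerM _ _ (- alpha / 2 + 1 / 2) (3 / 2) _
  ltac:(lra) Hsq) as HlB.
fold A in HlA; fold B in HlB.
assert (HD : is_lim (fun h0 => robin_D a k alpha h0 (xi h0)) p_infty (xD * B)).
(* The summand [0 * A] is the limit of the term of [robin_D] with factor [k / (2 * a * h0)]. *)
{ replace (xD * B) with (0 * A + xD * B) by ring.
  apply is_lim_plus'; apply is_lim_Rmult; assumption. }
assert (HD0 : xD * B <> 0) by nra.
(* The target takes the shape of [uR]: the limit of [C1R] is [uinf * xD * B / (xD * B)], which
   cancels to [uinf]. *)
replace (uD a uinf alpha xD x t) with
  (Rpower t (alpha / 2)
   * (uinf * xD * B / (xD * B)
        * kummerM (- alpha / 2) (1 / 2) (- (eta a x t ^ 2))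
      + - uinf * A / (xD * B) * eta a x t
        * kummerM (- alpha / 2 + 1 / 2) (3 / 2) (- (eta a x t ^ 2)))).
2:{ unfold uD; fold A B; field; lra. }
unfold uR.
apply is_lim_Rmult; [apply is_lim_const|].
apply is_lim_plus'.
- apply is_lim_Rmult; [|apply is_lim_const].
  apply is_lim_Rdiv; [exact HD0| |exact HD].
  apply is_lim_Rmult; [|exact HlB].
  apply is_lim_Rmult; [apply is_lim_const|exact Hxi].
- apply is_lim_Rmult; [|apply is_lim_const].
  apply is_lim_Rmult; [|apply is_lim_const].
  apply is_lim_Rdiv; [exact HD0| |exact HD].
  apply is_lim_Rmult; [apply is_lim_const|exact HlA].
Qed.

Theorem theorem4p1
  (a k gamma uinf beta delta alpha : R)
  (Ha : 0 < a) (Hk : 0 < k) (Hgamma : 0 < gamma) (Huinf : 0 < uinf)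
  (Hbd : delta <= beta) (Hbd1 : 0 < beta + delta + 1)
  (Halpha : alpha = beta - delta)
  (xiR : R -> R)
  (HxiR : forall h0 : R, 0 < h0 ->
     is_xiR a k gamma uinf alpha beta delta h0 (xiR h0))
  (xiD : R)
  (HxiD : is_xiD a k gamma uinf alpha beta delta xiD) :
  is_lim xiR p_infty (Finite xiD)
  /\ (forall t : R, 0 < t ->
        is_lim (fun h0 => free_boundary a (xiR h0) t) p_infty
          (Finite (free_boundary a xiD t)))
  /\ (forall x t : R, 0 < x -> 0 < t ->
        is_lim (fun h0 => uR a k uinf alpha h0 (xiR h0) x t) p_infty
          (Finite (uD a uinf alpha xiD x t))).
Proof.
assert (Hal : 0 <= alpha) by lra.
destruct HxiD as [[HD0 HDeq] _].
assert (He : is_lim (fun h0 => k / (2 * a * h0)) p_infty 0).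
(* The two expressions are matched for [h0 > 0] only, where the denominators do not vanish. *)
{ apply is_lim_ext_loc with (fun h0 => k / (2 * a) * / h0).
  { exists 0; intros h Hh; field; lra. }
  replace 0 with (k / (2 * a) * 0) by ring.
  apply is_lim_Rmult; [apply is_lim_const|].
  apply (is_lim_inv (fun y => y) p_infty p_infty); [apply is_lim_id|discriminate]. }
assert (Hlim : is_lim xiR p_infty xiD).
{ apply (is_lim_stefan_root alpha (beta + delta + 1)
           (stefan_const a k gamma uinf beta delta) xiD
           (fun h0 => k / (2 * a * h0))); try assumption.
  - intros h Hh; apply Rlt_le, Rdiv_lt_0_compat; nra.
  - intros h Hh; destruct (HxiR h Hh) as [[Hpos Heq] _].
    split; [exact Hpos|].
    apply stefan_lhs_of_eq; try assumption.
    apply Rlt_le, Rdiv_lt_0_compat; nra.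
  - apply stefan_lhs_of_eq; try assumption; [lra|].
    rewrite Rmult_0_l, Rplus_0_l; exact HDeq. }
split; [exact Hlim|split].
- intros t _; unfold free_boundary.
  repeat (apply is_lim_Rmult; [|apply is_lim_const]).
  apply is_lim_Rmult; [apply is_lim_const|exact Hlim].
- intros x t _ _; apply is_lim_uR; assumption.
Qed.
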